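(* Let $X$ and $U$ be non-trivial complex Hilbert spaces, let $A_s\in\mathcal L(X)$ and $B_s\in\mathcal L(U,X)$, and let $x_1=(x_1(k))_{k\in\mathbb N}$, $x_0=(x_0(k))_{k\in\mathbb N}$ be Bessel sequences in $X$ and $u_0=(u_0(k))_{k\in\mathbb N}$ a Bessel sequence in $U$ such that $x_1(k)=A_sx_0(k)+B_su_0(k)$ for all $k\in\mathbb N$. Let $\Xi_1,\Xi_0\in\mathcal L(\ell^2(\mathbb N),X)$ and $\Upsilon_0\in\mathcal L(\ell^2(\mathbb N),U)$ be the synthesis operators associated with $x_1,x_0,u_0$, respectively. Then for every fixed $\gamma\in(0,1)$ the following statements are equivalent: (i) The data $(x_1,x_0,u_0)$ are informative for stabilization with decay rate $\gamma$, and there exist a constant $c\ge0$ and a stabilizing gain $K\in\mathcal L(X,U)$ with decay rate $\gamma$ for $(x_1,x_0,u_0)$ such that the following inequality on $\ell^2(\mathbb N)$ holds: $$(\Xi_0+K^*\Upsilon_0)^*(\Xi_0+K^*\Upsilon_0)\le c^2(\Xi_0^*\Xi_0+\Upsilon_0^*\Upsilon_0)^2.$$ (ii) The sequence $x_0$ is a frame for $X$, and there exists a right inverse $\Xi_0^\dagger\in\mathcal L(X,\ell^2(\mathbb N))$ of $\Xi_0$ such that $\Xi_1\Xi_0^\dagger$ is power stable with decay rate $\gamma$.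
   Context: $\mathcal L(Y,Z)$ denotes the bounded linear operators from $Y$ to $Z$, $\mathcal L(Y)=\mathcal L(Y,Y)$; $\mathbb N=\{1,2,\dots\}$, $\mathbb N_0=\mathbb N\cup\{0\}$; $S\le T$ for self-adjoint operators means that $T-S$ is positive semidefinite. A sequence $(\eta_k)_{k\in\mathbb N}$ in a Hilbert space $Y$ is a Bessel sequence if there is $\alpha>0$ with $\sum_{k}|\langle y,\eta_k\rangle|^2\le\alpha\|y\|^2$ for all $y\in Y$; it is a frame for $Y$ if there are $\alpha,\beta>0$ with $\beta\|y\|^2\le\sum_k|\langle y,\eta_k\rangle|^2\le\alpha\|y\|^2$ for all $y\in Y$. The synthesis operator of a Bessel sequence is the bounded operator $\ell^2(\mathbb N)\to Y$, $w=(w_k)\mapsto\sum_{k=1}^\infty w_k\eta_k$. For $\gamma\in(0,1)$, a bounded operator $F$ is power stable with decay rate $\gamma$ if there is $M\ge1$ with $\|F^k\|\le M\gamma^k$ for all $k\in\mathbb N_0$. Define $\Sigma_{\mathrm{is}}:=\{(A,B)\in\mathcal L(X)\times\mathcal L(U,X): x_1(k)=Ax_0(k)+Bu_0(k)\ \text{for all }k\in\mathbb N\}$, and for $K\in\mathcal L(X,U)$, $M\ge1$, $\gamma>0$, $\Sigma_{K,M,\gamma}:=\{(A,B)\in\mathcal L(X)\times\mathcal L(U,X):\|(A+BK)^k\|\le M\gamma^k\ \text{for all }k\in\mathbb N_0\}$. For $\gamma\in(0,1)$, an operator $K\in\mathcal L(X,U)$ is a stabilizing gain with decay rate $\gamma$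 for $(x_1,x_0,u_0)$ if $\Sigma_{\mathrm{is}}\subseteq\Sigma_{K,M,\gamma}$ for some $M\ge1$. The data are informative for stabilization with decay rate $\gamma$ if such a $K$ exists. *)

(* Defs.v *)
From HB Require Import structures.
From mathcomp Require Import all_boot all_order all_algebra sesquilinear.
From mathcomp Require Import all_classical all_reals all_analysis.
From mathcomp Require Import complex.
From mathcomp Require Import ring lra.
Set Implicit Arguments.
Unset Strict Implicit.
Unset Printing Implicit Defensive.
Import Order.TTheory GRing.Theory Num.Theory.
Import numFieldNormedType.Exports.
Local Open Scope classical_set_scope.
Local Open Scope ring_scope.
Local Open Scope complex_scope.

Local Notation Re := complex.Re.
Local Notation Im := complex.Im.

(* The forms {dot X for Num.conj} are linear in the first argument and
   conjugate-linear in the second. *)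
HB.mixin Record isHilbert (R : realType) X & CompleteNormedModule R[i] X := {
  dotp : {dot X for (@Num.conj R[i])};
  dotp_norm : forall x, dotp x x = `|x| ^+ 2
}.

#[short(type="hilbertType")]
HB.structure Definition Hilbert (R : realType) :=
  {X of CompleteNormedModule R[i] X & isHilbert R X}.

Section ComplexAux.
Context {R : realType}.
Local Notation C := R[i].
Implicit Types (z : C).

Lemma conjcE z : Num.conj z = conjc z. Proof. by []. Qed.

Lemma normcE (V : normedZmodType C) (x : V) : `|x| = (Re `|x|)%:C.
Proof. by rewrite RRe_real ?normr_real. Qed.

Lemma Re_norm_ge0 (V : normedZmodType C) (x : V) : 0 <= Re `|x|.
Proof. by rewrite -ler0c -normcE. Qed.

Lemma Re_le z : `|Re z| <= Re `|z|.
Proof.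
rewrite normc_def /= -sqrtr_sqr ler_sqrt ?addr_ge0 ?sqr_ge0 //.
by rewrite lerDl sqr_ge0.
Qed.

Lemma Im_le z : `|Im z| <= Re `|z|.
Proof.
rewrite normc_def /= -sqrtr_sqr ler_sqrt ?addr_ge0 ?sqr_ge0 //.
by rewrite lerDr sqr_ge0.
Qed.

Lemma Re_normM z1 z2 : Re `|z1 * z2| = Re `|z1| * Re `|z2|.
Proof. by rewrite normrM [`|z1|]normcE [`|z2|]normcE -rmorphM. Qed.

Lemma Re_norm_conj z : Re `|z^*%R| = Re `|z|.
Proof. by rewrite conjcE !normc_def; case: z => a b /=; rewrite sqrrN. Qed.

Lemma Re_normD z1 z2 : Re `|z1 + z2| <= Re `|z1| + Re `|z2|.
Proof.
have := ler_normD z1 z2.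
by rewrite [`|z1 + z2|]normcE [`|z1|]normcE [`|z2|]normcE -rmorphD lecR.
Qed.

Lemma mulc_conj z : z * z^*%R = ((Re `|z|) ^+ 2)%:C.
Proof. by rewrite -normCK {1}normcE rmorphXn. Qed.

Lemma ReM z1 z2 : Re (z1 * z2) = Re z1 * Re z2 - Im z1 * Im z2.
Proof. by case: z1 => ? ?; case: z2. Qed.

Lemma ImM z1 z2 : Im (z1 * z2) = Re z1 * Im z2 + Im z1 * Re z2.
Proof. by case: z1 => ? ?; case: z2 => ? ?. Qed.

Lemma ReD z1 z2 : Re (z1 + z2) = Re z1 + Re z2.
Proof. by case: z1 => ? ?; case: z2. Qed.

Lemma ImD z1 z2 : Im (z1 + z2) = Im z1 + Im z2.
Proof. by case: z1 => ? ?; case: z2. Qed.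

Lemma ReB z1 z2 : Re (z1 - z2) = Re z1 - Re z2.
Proof. by case: z1 => ? ?; case: z2. Qed.

Lemma ImB z1 z2 : Im (z1 - z2) = Im z1 - Im z2.
Proof. by case: z1 => ? ?; case: z2. Qed.

Lemma Re_norm2 z : Re `|z| ^+ 2 = Re z ^+ 2 + Im z ^+ 2.
Proof. by rewrite normc_def /= sqr_sqrtr // addr_ge0 ?sqr_ge0. Qed.

End ComplexAux.

Section DotNorm.
Context {R : realType} (U : lmodType R[i]) (f : {dot U for (@Num.conj R[i])}).

Definition dnormr (u : U) : R := Num.sqrt (Re (f u u)).

Lemma dnormr_ge0 u : 0 <= dnormr u. Proof. exact: sqrtr_ge0. Qed.

Lemma Re_dnorm_ge0 u : 0 <= Re (f u u).
Proof. by have := dnorm_ge0 f u; rewrite lecE /= => /andP[]. Qed.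

Lemma dnormr_sqr u : (dnormr u ^+ 2)%:C = f u u.
Proof.
rewrite sqr_sqrtr ?Re_dnorm_ge0 // RRe_real //.
by rewrite ger0_real // dnorm_ge0.
Qed.

Lemma dnormrZ a u : dnormr (a *: u) = Re `|a| * dnormr u.
Proof.
rewrite /dnormr dnormZ normcE -rmorphXn /= ReM /= mul0r subr0.
by rewrite sqrtrM ?sqr_ge0 // sqrtr_sqr ger0_norm ?(Re_norm_ge0 a).
Qed.

Lemma dnormr_eq0 u : dnormr u = 0 -> u = 0.
Proof.
move=> u0; have := dnormr_sqr u; rewrite u0 expr0n /= => /esym/eqP.
by rewrite dnorm_eq0 => /eqP.
Qed.

Lemma dot_conj u v : f u v = (f v u)^*%R.
Proof. by rewrite hermC expr0 mul1r. Qed.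

Lemma dnormrD2 u v :
  dnormr (u + v) ^+ 2 = dnormr u ^+ 2 + dnormr v ^+ 2 + 2 * Re (f u v).
Proof.
apply: (@complexI R); rewrite !rmorphD /= !dnormr_sqr dnormD.
by congr (_ + _); rewrite conjcE addcJ rmorphM /= rmorph_nat.
Qed.

Lemma Re_cauchy_schwarz u v : Re (f u v) <= dnormr u * dnormr v.
Proof.
have [u0|u0] := eqVneq (dnormr u) 0.
  by rewrite u0 mul0r (dnormr_eq0 u0) linear0l.
have [v0|v0] := eqVneq (dnormr v) 0.
  by rewrite v0 mulr0 (dnormr_eq0 v0) linear0r.
have up : 0 < dnormr u by rewrite lt_neqAle eq_sym u0 dnormr_ge0.
have vp : 0 < dnormr v by rewrite lt_neqAle eq_sym v0 dnormr_ge0.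
have := sqr_ge0 (dnormr ((dnormr v)%:C *: u + (- dnormr u)%:C *: v)).
rewrite dnormrD2 !dnormrZ linearZl_LR linearZr_LR /= conjcE conjc_real mulrA.
rewrite -rmorphM /= ReM /= mul0r subr0 !expr0n /= !addr0 !sqrtr_sqr normrN !gtr0_norm //.
set a := dnormr u in up *; set b := dnormr v in vp *; set r := Re _ => h.
have : 0 <= (a * b) * (a * b - r) by nra.
by rewrite pmulr_rge0 ?mulr_gt0 // subr_ge0.
Qed.

Lemma dnormrD u v : dnormr (u + v) <= dnormr u + dnormr v.
Proof.
rewrite -(@ler_pXn2r _ 2) ?nnegrE ?addr_ge0 ?dnormr_ge0 //.
rewrite dnormrD2 sqrrD; have := Re_cauchy_schwarz u v; lra.
Qed.

Lemma cauchy_schwarz u v : Re `|f u v| <= dnormr u * dnormr v.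
Proof.
have [->|n0] := eqVneq (f u v) 0.
  by rewrite normr0 mulr_ge0 ?dnormr_ge0.
pose a := (f u v)^*%R / `|f u v|.
have an : Re `|a| = 1.
  rewrite /a normrM normfV normr_id.
  have -> : `|(f u v)^*%R| = `|f u v| by rewrite [LHS]normcE Re_norm_conj -normcE.
  by rewrite divff ?normr_eq0.
have := Re_cauchy_schwarz (a *: u) v; rewrite dnormrZ an mul1r.
rewrite linearZl_LR /= /a mulrAC [_ * f u v]mulrC -normCK.
by rewrite expr2 -mulrA divff ?mulr1 ?normr_eq0.
Qed.

End DotNorm.
Section Ell2.
Context {R : realType}.
Local Notation C := R[i].
Implicit Types (u v w z : nat -> C) (a : C).

Definition square_summable : {pred nat -> C} :=
  fun w => `[< cvgn (series (fun k => Re `|w k| ^+ 2)) >].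

(* Summed componentwise because R[i] carries no complete structure. *)
Definition csum z : C :=
  limn (series (fun k => Re (z k))) +i* limn (series (fun k => Im (z k))).

Definition csummable z := cvgn (series (fun k => Re `|z k|)).

Lemma nnseries_cvg (s t : nat -> R) : (forall k, 0 <= s k) ->
  (forall k, s k <= t k) -> cvgn (series t) -> cvgn (series s).
Proof.
move=> s0 st; apply: series_le_cvg => // k; exact: le_trans (s0 k) (st k).
Qed.

Lemma csummable_Re z : csummable z -> cvgn (series (fun k => Re (z k))).
Proof.
move=> zs; apply: normed_cvg; apply: nnseries_cvg zs => k //=; exact: Re_le.
Qed.

Lemma csummable_Im z : csummable z -> cvgn (series (fun k => Im (z k))).
Proof.
move=> zs; apply: normed_cvg; apply: nnseries_cvg zs => k //=; exact: Im_le.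
Qed.

Lemma csummable_lin a z1 z2 : csummable z1 -> csummable z2 ->
  csummable (fun k => a * z1 k + z2 k).
Proof.
move=> s1 s2; pose t := Re `|a| *: (fun k => Re `|z1 k|) + (fun k => Re `|z2 k|).
apply: (@nnseries_cvg _ t) => [k|k|]; first exact: Re_norm_ge0.
  by rewrite (le_trans (Re_normD _ _)) // Re_normM.
by apply: is_cvg_seriesD => //; apply: is_cvg_seriesZ.
Qed.

Lemma csum_lin a z1 z2 : csummable z1 -> csummable z2 ->
  csum (fun k => a * z1 k + z2 k) = a * csum z1 + csum z2.
Proof.
move=> s1 s2.
have [r1 i1] := (csummable_Re s1, csummable_Im s1).
have [r2 i2] := (csummable_Re s2, csummable_Im s2).
have eR : (fun k => Re (a * z1 k + z2 k)) =
    (Re a *: (fun k => Re (z1 k)) + (- Im a) *: (fun k => Im (z1 k))) +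
    (fun k => Re (z2 k)).
  by apply/funext => k; rewrite ReD ReM -mulNr.
have eI : (fun k => Im (a * z1 k + z2 k)) =
    (Re a *: (fun k => Im (z1 k)) + Im a *: (fun k => Re (z1 k))) +
    (fun k => Im (z2 k)).
  by apply/funext => k; rewrite ImD ImM.
have Zr c (s : nat -> R) : cvgn (series s) -> cvgn (series (c *: s)).
  exact: is_cvg_seriesZ.
have L c d (s t x : nat -> R) : cvgn (series s) -> cvgn (series t) ->
    cvgn (series x) -> limn (series ((c *: s + d *: t) + x)) =
    c * limn (series s) + d * limn (series t) + limn (series x).
  move=> cs ct cx; rewrite lim_seriesD //; last first.
    by apply: is_cvg_seriesD; exact: Zr.
  rewrite lim_seriesD; [|exact: Zr..].
  by rewrite !lim_seriesZ.
by apply/eqP; rewrite eq_complex ReD ImD ReM ImM /= eR eI !L // mulNr !eqxx.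
Qed.

Lemma csum_conj z : csummable z -> csum (fun k => (z k)^*%R) = (csum z)^*%R.
Proof.
move=> zs; apply/eqP; rewrite eq_complex /=.
have -> : (fun k => Re (z k)^*%R) = (fun k => Re (z k)).
  apply/funext => k; rewrite conjcE.
  by rewrite -[RHS]/(Re (z k)); case: (z k).
have -> : (fun k => Im (z k)^*%R) = - (fun k => Im (z k)).
  apply/funext => k; rewrite conjcE.
  by rewrite -[RHS]/(- Im (z k)); case: (z k).
by rewrite lim_seriesN ?eqxx //; exact: csummable_Im.
Qed.

Lemma square_summable_mul u v : u \in square_summable -> v \in square_summable ->
  csummable (fun k => u k * (v k)^*%R).
Proof.
move=> /asboolP us /asboolP vs.
pose t := (fun k => Re `|u k| ^+ 2) + (fun k => Re `|v k| ^+ 2).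
apply: (@nnseries_cvg _ t) => [k|k|]; first exact: Re_norm_ge0.
  rewrite Re_normM Re_norm_conj -[t k]/(Re `|u k| ^+ 2 + Re `|v k| ^+ 2).
  have := sqr_ge0 (Re `|u k| - Re `|v k|).
  have := Re_norm_ge0 (u k); have := Re_norm_ge0 (v k); nra.
exact: is_cvg_seriesD.
Qed.

Lemma square_summable_submod : submod_closed square_summable.
Proof.
split=> [|a u v /asboolP us /asboolP vs].
  apply/asboolP; rewrite (_ : series _ = cst 0); first exact: is_cvg_cst.
  by apply/funext => n; apply: big1 => i _;
  rewrite (_ : (0 : nat -> C) i = 0) // normr0 expr0n.
apply/asboolP.
pose t := (2 * Re `|a| ^+ 2) *: (fun k => Re `|u k| ^+ 2) +
          (2 : R) *: (fun k => Re `|v k| ^+ 2).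
apply: (@nnseries_cvg _ t) => [k|k|]; first exact: sqr_ge0.
  have h := Re_normD (a * u k) (v k); rewrite Re_normM in h.
  rewrite -[t k]/(2 * Re `|a| ^+ 2 * Re `|u k| ^+ 2 + 2 * Re `|v k| ^+ 2).
  rewrite -[X in Re `|X|]/(a * u k + v k).
  have := sqr_ge0 (Re `|a| * Re `|u k| - Re `|v k|).
  have := Re_norm_ge0 (a * u k + v k).
  move: h; set p := Re `|a|; set q := Re `|u k|; set r := Re `|v k|.
  by set s := Re _ => h s0 h2; nra.
by apply: is_cvg_seriesD; apply: is_cvg_seriesZ.
Qed.

HB.instance Definition _ :=
  GRing.isSubmodClosed.Build C (nat -> C) square_summable square_summable_submod.

Record ell2 := Ell2 {
  ell2_seq :> nat -> C;
  ell2_summable : ell2_seq \in square_summable }.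

HB.instance Definition _ := [isSub for ell2_seq].
HB.instance Definition _ := [Choice of ell2 by <:].
HB.instance Definition _ := [SubChoice_isSubLmodule of ell2 by <:].

Definition ell2_dot (u v : ell2) : C := csum (fun k => u k * (v k)^*%R).

Lemma ell2_mul_summable (u v : ell2) : csummable (fun k => u k * (v k)^*%R).
Proof. exact: square_summable_mul (ell2_summable u) (ell2_summable v). Qed.

Let ell2_dot_bilinear :
  bilinear_for (GRing.Scale.Law.clone _ _ ( *%R ) _)
    (GRing.Scale.Law.clone _ _ ((@Num.conj C) \; *%R) _) ell2_dot.
Proof.
split=> [w | u] a x y /=; rewrite /ell2_dot.
  rewrite -csum_lin; try exact: ell2_mul_summable.
  congr csum; apply/funext => k.
  by rewrite -[(a *: x + y) k]/(a * x k + y k) mulrDl mulrA.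
rewrite -[RHS]/(a^*%R * _ + _) -csum_lin; try exact: ell2_mul_summable.
congr csum; apply/funext => k.
by rewrite -[(a *: x + y) k]/(a * x k + y k) rmorphD rmorphM mulrDr mulrCA.
Qed.

HB.instance Definition _ :=
  bilinear_isBilinear.Build C ell2 ell2 C _ _ ell2_dot ell2_dot_bilinear.

Let ell2_dot_herm (u v : ell2) :
  ell2_dot u v = (-1) ^+ false * (ell2_dot v u)^*%R.
Proof.
rewrite expr0 mul1r /ell2_dot -csum_conj; last exact: ell2_mul_summable.
by congr csum; apply/funext => k; rewrite rmorphM /= conjCK mulrC.
Qed.

HB.instance Definition _ :=
  isHermitianSesquilinear.Build C ell2 false (@Num.conj C) ell2_dot ell2_dot_herm.

Lemma ell2_dotE (u : ell2) :
  ell2_dot u u = (limn (series (fun k => Re `|u k| ^+ 2)))%:C.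
Proof.
rewrite /ell2_dot /csum; apply/eqP; rewrite eq_complex /=; apply/andP; split.
  by apply/eqP; congr (limn (series _)); apply/funext => k; rewrite mulc_conj.
apply/eqP; rewrite (_ : series _ = cst 0); first exact: lim_cst.
by apply/funext => n; apply: big1 => i _; rewrite mulc_conj.
Qed.

Lemma ell2_partial_sum_le (u : ell2) n :
  \sum_(0 <= k < n) Re `|u k| ^+ 2 <= Re (ell2_dot u u).
Proof.
rewrite ell2_dotE /=.
apply: (nondecreasing_cvgn_le (u_ := series (fun k => Re `|u k| ^+ 2))).
  by apply: nondecreasing_series => i _ _; exact: sqr_ge0.
exact/asboolP/ell2_summable.
Qed.

Lemma ell2_coord_le (u : ell2) k : Re `|u k| ^+ 2 <= Re (ell2_dot u u).
Proof.
apply: le_trans (ell2_partial_sum_le u k.+1).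
by rewrite big_nat_recr //= lerDr sumr_ge0 // => i _; rewrite sqr_ge0.
Qed.

Let ell2_dot_gt0 (u : ell2) : u != 0 -> 0 < ell2_dot u u.
Proof.
move=> u0; rewrite ell2_dotE ltcR lt_neqAle -[X in _ && (_ <= X)]/(Re (_%:C)).
rewrite -ell2_dotE (le_trans (sqr_ge0 _) (ell2_coord_le u 0)) andbT.
apply: contra_neq u0 => /esym l0; apply/val_inj/funext => k /=.
have := ell2_coord_le u k; rewrite ell2_dotE /= l0 => h.
have /eqP : Re `|u k| ^+ 2 = 0 by apply/le_anti; rewrite h sqr_ge0.
by rewrite sqrf_eq0 => /eqP h0; apply/normr0_eq0; rewrite normcE h0.
Qed.

HB.instance Definition _ := isDotProduct.Build C ell2 ell2_dot ell2_dot_gt0.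

Definition ell2_norm (u : ell2) : C :=
  (dnormr (ell2_dot : {dot ell2 for (@Num.conj C)}) u)%:C.

Let ell2_normD (u v : ell2) : ell2_norm (u + v) <= ell2_norm u + ell2_norm v.
Proof. by rewrite -rmorphD lecR dnormrD. Qed.

Let ell2_normZ a (u : ell2) : ell2_norm (a *: u) = `|a| * ell2_norm u.
Proof. by rewrite /ell2_norm dnormrZ rmorphM [in RHS]normcE. Qed.

Let ell2_norm_eq0 (u : ell2) : ell2_norm u = 0 -> u = 0.
Proof. by move=> /complexI /dnormr_eq0. Qed.

HB.instance Definition _ :=
  Lmodule_isNormed.Build C ell2 ell2_normD ell2_normZ ell2_norm_eq0.

Lemma ell2_normE (u : ell2) :
  `|u| = (dnormr (ell2_dot : {dot ell2 for (@Num.conj C)}) u)%:C.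
Proof. by []. Qed.

Lemma ell2_norm_sqr (u : ell2) : ell2_dot u u = `|u| ^+ 2.
Proof. by rewrite ell2_normE -rmorphXn /= dnormr_sqr. Qed.

Lemma ell2_partial_sum_norm (u : ell2) n :
  \sum_(0 <= k < n) Re `|u k| ^+ 2 <= Re `|u| ^+ 2.
Proof.
apply: le_trans (ell2_partial_sum_le u n) _.
by rewrite ell2_norm_sqr ell2_normE -rmorphXn.
Qed.

Lemma ell2_coord_norm (u : ell2) k : Re `|u k| <= Re `|u|.
Proof.
rewrite -(@ler_pXn2r _ 2) ?nnegrE ?Re_norm_ge0 //.
apply: le_trans (ell2_coord_le u k) _.
by rewrite ell2_norm_sqr ell2_normE -rmorphXn.
Qed.

Let ell2_complete (F : set_system ell2) : ProperFilter F -> cauchy F -> cvg F.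
Proof.
move=> FF /cauchy_ballP Fc.
have Fn (e : R) : 0 < e ->
    \forall x \near F, \forall y \near F, Re `|x - y| < e.
  move=> e0; have e0' : 0 < e%:C by rewrite -(ltcR 0) in e0.
  apply: nearP_dep; apply: filterS (Fc _ e0') => -[x y] h.
  change (is_true (Re `|x - y| < e)); rewrite -ltcR -normcE.
  by move: h; rewrite -ball_normE.
have Fpart (g : C -> R) k : {morph g : x y / x - y} ->
    (forall z : C, `|g z| <= Re `|z|) -> cvg (g (x k) @[x --> F]).
  move=> gB gle; apply: cauchy_cvg; apply: cauchy_exP => e e0.
  have [x xF] := filter_ex (Fn e e0); exists (g (x k)).
  apply: filterS xF => y xy; apply: le_lt_trans xy.
  rewrite -[X in `|X|]gB; apply: le_trans (gle _) _.
  exact: ell2_coord_norm (x - y) k.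
have FRe k : cvg (Re (x k) @[x --> F]).
  by apply: Fpart => [[a b] [c d]|z] //; exact: Re_le.
have FIm k : cvg (Im (x k) @[x --> F]).
  by apply: Fpart => [[a b] [c d]|z] //; exact: Im_le.
pose l k := lim (Re (x k) @[x --> F]) +i* lim (Im (x k) @[x --> F]).
have Fl (x : ell2) n (e : R) : (\forall y \near F, Re `|x - y| < e) ->
    \sum_(0 <= k < n) Re `|x k - l k| ^+ 2 <= e ^+ 2.
  move=> xe.
  have cv : (\sum_(0 <= k < n) Re `|x k - y k| ^+ 2) @[y --> F] -->
      \sum_(0 <= k < n) Re `|x k - l k| ^+ 2.
    apply: cvg_big => [|k _]; first exact: add_continuous.
    under eq_cvg do rewrite Re_norm2 ReB ImB !expr2.
    rewrite Re_norm2 ReB ImB !expr2.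
    have cR : Re (x k) - Re (y k) @[y --> F] --> Re (x k) - Re (l k).
      by apply: cvgB; [exact: cvg_cst|exact: FRe].
    have cI : Im (x k) - Im (y k) @[y --> F] --> Im (x k) - Im (l k).
      by apply: cvgB; [exact: cvg_cst|exact: FIm].
    by apply: cvgD; apply: cvgM.
  rewrite -(cvg_lim _ cv) //; apply: limr_le; first exact: cvgP cv.
  apply: filterS xe => y xy; apply: le_trans (ell2_partial_sum_norm (x - y) n) _.
  by rewrite ler_sqr ?nnegrE ?Re_norm_ge0 ?ltW // (le_lt_trans _ xy) ?Re_norm_ge0.
have Fs (x : ell2) (e : R) : (\forall y \near F, Re `|x - y| < e) ->
    (fun k => x k - l k) \in square_summable.
  move=> xe; apply/asboolP; apply: nondecreasing_is_cvgn.
    by apply: nondecreasing_series => i _ _; exact: sqr_ge0.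
  by exists (e ^+ 2) => _ [n _ <-]; exact: Fl.
have ls : l \in square_summable.
  have [x xF] := filter_ex (Fn 1 ltr01).
  have -> : l = ell2_seq x - (fun k => x k - l k).
    apply/funext => k.
    by rewrite -[RHS]/(x k - (x k - l k)) opprB addrCA subrr addr0.
  by apply: rpredB; [exact: ell2_summable|exact: Fs xF].
apply/cvg_ex; exists (Ell2 ls); apply/cvgrPdist_le => /= e e0.
have er : e = (Re e)%:C by rewrite RRe_real // gtr0_real.
have re0 : 0 < Re e by rewrite er ltcR in e0.
apply: filterS (Fn _ re0) => x xe.
have n0 := Re_norm_ge0 (x - Ell2 ls); have e0' := ltW re0.
rewrite distrC er normcE lecR -(@ler_pXn2r _ 2) //.
have -> : Re `|x - Ell2 ls| ^+ 2 =
    limn (series (fun k => Re `|(x - Ell2 ls) k| ^+ 2)).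
  by apply: complexI; rewrite -ell2_dotE ell2_norm_sqr rmorphXn [in RHS]normcE.
apply: limr_le; first exact/asboolP/ell2_summable.
by apply: nearW => n; exact: Fl.
Qed.

HB.instance Definition _ := Uniform_isComplete.Build ell2 ell2_complete.

HB.instance Definition _ := @isHilbert.Build R ell2 ell2_dot ell2_norm_sqr.

End Ell2.
Arguments ell2 R : clear implicits.


Section BoundedOperators.
Context {R : realType} (Y Z : normedModType R[i]).
Local Notation C := R[i].

Definition bounded_operator : {pred Y -> Z} := fun T =>
  `[< linear T /\ exists M : R, forall y, Re `|T y| <= M * Re `|y| >].

Lemma bounded_operator_submod : submod_closed bounded_operator.
Proof.
split=> [|a S T /asboolP[Sl [M SM]] /asboolP[Tl [N TN]]].
  apply/asboolP; split=> [b x y|].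
    by rewrite -[LHS]/(0 : Z) -[RHS]/(b *: 0 + 0 : Z) scaler0 addr0.
  by exists 0 => y; rewrite -[X in Re `|X|]/(0 : Z) normr0 mul0r.
apply/asboolP; split=> [b x y|].
  rewrite -[LHS]/(a *: S (b *: x + y) + T (b *: x + y)) Sl Tl.
  rewrite -[RHS]/(b *: (a *: S x + T x) + (a *: S y + T y)).
  by rewrite !scalerDr !scalerA [b * a]mulrC addrACA.
exists (Re `|a| * M + N) => y.
rewrite -[X in Re `|X|]/(a *: S y + T y).
apply: (@le_trans _ _ (Re `|a *: S y| + Re `|T y|)).
  by rewrite -lecR rmorphD /= -!normcE; exact: ler_normD.
rewrite mulrDl; apply: lerD => //.
have -> : Re `|a *: S y| = Re `|a| * Re `|S y|.
  by apply: complexI; rewrite rmorphM /= -!normcE normrZ.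
by rewrite -mulrA; apply: ler_wpM2l => //; exact: Re_norm_ge0.
Qed.

HB.instance Definition _ :=
  GRing.isSubmodClosed.Build C (Y -> Z) bounded_operator bounded_operator_submod.

Record bop := Bop {
  bop_fun :> Y -> Z;
  bop_bounded : bop_fun \in bounded_operator }.

HB.instance Definition _ := [isSub for bop_fun].
HB.instance Definition _ := [Choice of bop by <:].
HB.instance Definition _ := [SubChoice_isSubLmodule of bop by <:].

Lemma bop_linear (T : bop) : linear T.
Proof. by have /asboolP[] := bop_bounded T. Qed.

HB.instance Definition _ (T : bop) :=
  GRing.isLinear.Build C Y Z _ (bop_fun T) (bop_linear T).

Lemma bop_bound (T : bop) : exists M : R, forall y, Re `|T y| <= M * Re `|y|.
Proof. by have /asboolP[] := bop_bounded T. Qed.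

Definition opnorm (T : bop) : R :=
  sup [set Re `|T y| | y in [set y : Y | Re `|y| <= 1]].

End BoundedOperators.

Notation "''L' ( Y , Z )" := (bop Y Z)
  (at level 8, format "''L' ( Y ,  Z )") : type_scope.

Section Composition.
Context {R : realType}.

Lemma bop_comp_subproof (X Y Z : normedModType R[i]) (S : 'L(Y, Z)) (T : 'L(X, Y)) :
  S \o T \in @bounded_operator R X Z.
Proof.
have [M SM] := bop_bound S; have [N TN] := bop_bound T.
apply/asboolP; split=> [a x y /=|]; first by rewrite !linearP.
exists (`|M| * N) => x /=; apply: le_trans (SM _) _.
apply: (@le_trans _ _ (`|M| * Re `|T x|)).
  by apply: ler_wpM2r; [exact: Re_norm_ge0|exact: ler_norm].
by rewrite -mulrA; apply: ler_wpM2l.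
Qed.

Definition bop_comp (X Y Z : normedModType R[i]) (S : 'L(Y, Z)) (T : 'L(X, Y)) :
  'L(X, Z) := Bop (bop_comp_subproof S T).

Lemma bop_id_subproof (X : normedModType R[i]) : id \in @bounded_operator R X X.
Proof. by apply/asboolP; split=> //; exists 1 => y; rewrite mul1r. Qed.

Definition bop_id (X : normedModType R[i]) : 'L(X, X) := Bop (bop_id_subproof X).

Definition bop_pow (X : normedModType R[i]) (F : 'L(X, X)) (k : nat) : 'L(X, X) :=
  iter k (bop_comp F) (bop_id X).

End Composition.

Section OperatorEvaluation.
Context {R : realType} (X Y Z : normedModType R[i]).
Implicit Types (S T : 'L(Y, Z)).

Lemma bop_eqP S T : (forall y, S y = T y) -> S = T.
Proof. by move=> h; apply/val_inj/funext. Qed.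

Lemma bop_addE S T y : (S + T) y = S y + T y. Proof. by []. Qed.

Lemma bop_oppE T y : (- T) y = - T y. Proof. by []. Qed.

Lemma bop_scaleE (a : R[i]) T y : (a *: T) y = a *: T y. Proof. by []. Qed.

Lemma bop_compE T (S : 'L(X, Y)) x : bop_comp T S x = T (S x).
Proof. by []. Qed.

End OperatorEvaluation.

Section Adjoint.
Context {R : realType}.
Local Notation C := R[i].

Section Riesz.
Variable X : hilbertType R.
Implicit Types x y : X.

Lemma hnormE x : dnormr dotp x = Re `|x|.
Proof.
rewrite /dnormr dotp_norm normcE -rmorphXn /= sqrtr_sqr ger0_norm //.
exact: Re_norm_ge0.
Qed.

Lemma hnormB x y : Re `|x - y| = Re `|y - x|. Proof. by rewrite distrC. Qed.

Lemma hnorm_ge x y : `|Re `|x| - Re `|y| | <= Re `|x - y|.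
Proof.
have h (a b : X) : Re `|a| - Re `|b| <= Re `|a - b|.
  by rewrite -!hnormE lerBlDr -{1}(subrK b a) dnormrD.
by rewrite ler_norml h andbT lerNl opprB (le_trans (h _ _)) // hnormB.
Qed.

Lemma lipschitz_cvg (F : set_system X) (x0 : X) (g : X -> R) (M : R) :
  ProperFilter F -> F --> x0 -> 0 < M ->
  (forall x y, `|g x - g y| <= M * Re `|x - y|) -> g x @[x --> F] --> g x0.
Proof.
move=> FF Fx M0 gM; apply/cvgrPdist_lt => e e0.
have e0' : 0 < (e / M)%:C by rewrite ltcR divr_gt0.
have /cvgrPdist_lt/(_ _ e0') := Fx.
apply: filterS => x; rewrite normcE ltcR ltr_pdivlMr // mulrC.
exact: le_lt_trans (gM _ _).
Qed.

Lemma riesz (f : X -> C) (M : R) : scalar f ->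
  (forall x, Re `|f x| <= M * Re `|x|) -> exists y, forall x, f x = dotp x y.
Proof.
move=> flin fM.
have fD x y : f (x + y) = f x + f y by rewrite -[x]scale1r flin mul1r scale1r.
have f0 : f 0 = 0.
  have := fD 0 0; rewrite addr0 => /eqP.
  by rewrite addrC -subr_eq subrr => /eqP.
have fZ a x : f (a *: x) = a * f x by rewrite -[a *: x]addr0 flin f0 addr0.
have fB x y : f (x - y) = f x - f y by rewrite -scaleN1r addrC flin mulN1r addrC.
pose q x := Re `|x| ^+ 2 - 2 * Re (f x).
have qlb x : - M ^+ 2 <= q x.
  have h : Re (f x) <= M * Re `|x|.
    by apply: le_trans (ler_norm _) _; apply: le_trans (Re_le _) _.
  by rewrite /q; have := sqr_ge0 (Re `|x| - M); nra.
pose m := inf (range q).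
have qinf : has_inf (range q).
  by split; [exists (q 0), 0|exists (- M ^+ 2) => _ [x _ <-]].
have mq x : m <= q x by apply: ge_inf; [exact: qinf.2|exists x].
have qpar x y : Re `|x - y| ^+ 2 = 2 * q x + 2 * q y - 4 * q (2^-1%:C *: (x + y)).
  have hn : Re `|2^-1%:C : C| = 2^-1.
    by rewrite ger0_norm //; rewrite lecR invr_ge0.
  rewrite /q -!hnormE dnormrZ hn exprMn !dnormrD2.
  have -> : dnormr dotp (- y) = dnormr dotp y.
    by rewrite -scaleN1r dnormrZ normrN1 mul1r.
  rewrite linearNr /= fZ ReM /= mul0r subr0 fD ReD.
  have -> : Re (- dotp x y) = - Re (dotp x y) by case: (dotp x y).
  by field.
pose A (e : R) := [set x | q x < m + e].
pose F := filter_from [set e : R | 0 < e] A.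
have FF : ProperFilter F.
  apply: filter_from_proper; last first.
    move=> e e0; have [_ [x _ <-] xm] := inf_adherent e0 qinf.
    by exists x.
  apply: filter_from_filter; first by exists 1; exact: ltr01.
  move=> e1 e2 /= e10 e20; exists (Num.min e1 e2) => /=.
    by rewrite lt_min e10.
  move=> x; rewrite /A /= => h; split; apply: lt_le_trans h _; rewrite lerD2l ge_min.
    by rewrite lexx.
  by rewrite lexx orbT.
have Fq e : 0 < e -> F (A e) by move=> e0; exists e.
have cF : cvg F.
  apply: cauchy_cvg; apply: cauchy_exP => e e0.
  have er : e = (Re e)%:C by rewrite RRe_real // gtr0_real.
  have re0 : 0 < Re e by rewrite er ltcR in e0.
  have d0 : 0 < Re e ^+ 2 / 4 by rewrite divr_gt0 ?exprn_gt0.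
  have [x xA] := filter_ex (Fq _ d0); exists x.
  apply: filterS (Fq _ d0) => y yA.
  rewrite -ball_normE /ball_ /= er normcE ltcR -(@ltr_pXn2r _ 2) ?nnegrE //; last 2 first.
  - exact: Re_norm_ge0.
  - exact: ltW.
  rewrite qpar; have := mq (2^-1%:C *: (x + y)).
  by rewrite /A /= in xA yA *; lra.
pose x0 := lim F.
have Fx0 : F --> x0 by [].
have cq : q x @[x --> F] --> q x0.
  have cn : Re `|x| @[x --> F] --> Re `|x0|.
    by apply: (@lipschitz_cvg F x0 _ 1) => // x y; rewrite mul1r hnorm_ge.
  apply: cvgB; first by rewrite expr2; under eq_cvg do rewrite expr2; exact: cvgM.
  apply: cvgMl_tmp => //.
  apply: (@lipschitz_cvg F x0 (fun x => Re (f x)) (`|M| + 1)) => // x y.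
  rewrite -ReB -fB; apply: le_trans (Re_le _) _; apply: le_trans (fM _) _.
  apply: ler_wpM2r; first exact: Re_norm_ge0.
  by have := ler_norm M; lra.
have qx0 : q x0 = m.
  apply/le_anti; rewrite mq andbT; apply/ler_addgt0Pr => e e0.
  rewrite -(cvg_lim _ cq) //; apply: limr_le; first exact: cvgP cq.
  by apply: filterS (Fq _ e0) => x; exact: ltW.
have key h : Re (f h) = Re (dotp h x0).
  apply/eqP; rewrite -subr_eq0; apply/eqP.
  set b := (X in X = 0).
  have ht (t : R) : 0 <= t ^+ 2 * Re `|h| ^+ 2 - 2 * t * b.
    have := mq (t%:C *: h + x0); rewrite -qx0 /q -!hnormE dnormrD2 fD fZ ReD ReM.
    rewrite dnormrZ linearZl_LR /= ReM /= !mul0r !subr0 !expr0n /= !addr0.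
    rewrite sqrtr_sqr exprMn -normrX ger0_norm ?sqr_ge0 // hnormE /b; lra.
  have [->//|b0] := eqVneq b 0.
  pose N := Re `|h| ^+ 2 + 1.
  have N0 : 0 < N by rewrite ltr_pwDr // sqr_ge0.
  have := ht (b / N); rewrite (_ : _ - _ = b ^+ 2 / N ^+ 2 * (Re `|h| ^+ 2 - 2 * N)); last first.
    by field; rewrite gt_eqF.
  rewrite pmulr_rge0; last first.
    by apply: divr_gt0; [rewrite exprn_even_gt0|rewrite exprn_gt0].
  by rewrite /N; have := sqr_ge0 (Re `|h|); lra.
exists x0 => x; apply/eqP; rewrite eq_complex key eqxx /=.
have := key ('i%C *: x); rewrite fZ linearZl_LR /= !ReM /=.
by rewrite !mul0r !sub0r !mul1r => /oppr_inj ->.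
Qed.

Lemma dotp_ext y1 y2 : (forall x, dotp x y1 = dotp x y2) -> y1 = y2.
Proof.
move=> h; apply/eqP; rewrite -subr_eq0 -(dnorm_eq0 dotp) linearBr /=.
by rewrite h subrr.
Qed.

End Riesz.

Lemma adjoint_exists (Y Z : hilbertType R) (T : 'L(Y, Z)) :
  exists S : 'L(Z, Y), forall y z, dotp (T y) z = dotp y (S z).
Proof.
have [M TM] := bop_bound T.
have ex z : exists s, forall y, dotp (T y) z = dotp y s.
  apply: (@riesz _ _ (`|M| * Re `|z|)) => [a x y|y].
    by rewrite linearP linearPl.
  apply: le_trans (cauchy_schwarz dotp _ _) _; rewrite !hnormE mulrAC.
  apply: ler_wpM2r; first exact: Re_norm_ge0.
  apply: le_trans (TM y) _; apply: ler_wpM2r; first exact: Re_norm_ge0.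
  exact: ler_norm.
have [S SE] := choice ex.
have Sb : S \in @bounded_operator R Z Y.
  apply/asboolP; split=> [a x y|].
    by apply: dotp_ext => u; rewrite -SE linearPr linearPr /= !SE.
  exists `|M| => z.
  have [->|z0] := eqVneq (S z) 0.
    by rewrite normr0 mulr_ge0 // Re_norm_ge0.
  have n0 : 0 < Re `|S z| by rewrite -ltcR -normcE normr_gt0.
  rewrite -(ler_pM2l n0).
  have := cauchy_schwarz dotp (T (S z)) z; rewrite SE dotp_norm !hnormE.
  rewrite normrX normr_id normcE -rmorphXn /= -expr2.
  move=> /le_trans; apply.
  rewrite mulrA ler_wpM2r ?Re_norm_ge0 // mulrC.
  apply: le_trans (TM _) _; apply: ler_wpM2r; first exact: Re_norm_ge0.
  exact: ler_norm.
by exists (Bop Sb).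
Qed.

Definition adjoint (Y Z : hilbertType R) (T : 'L(Y, Z)) : 'L(Z, Y) :=
  projT1 (cid (adjoint_exists T)).

Lemma adjointE (Y Z : hilbertType R) (T : 'L(Y, Z)) y z :
  dotp (T y) z = dotp y (adjoint T z).
Proof. exact: projT2 (cid (adjoint_exists T)) y z. Qed.

End Adjoint.

Section OperatorNorm.
Context {R : realType} (Y Z : normedModType R[i]) (T : 'L(Y, Z)).

Lemma opnorm_has_sup :
  has_sup [set Re `|T y| | y in [set y : Y | Re `|y| <= 1]].
Proof.
split; first by exists (Re `|T 0|), 0 => //=; rewrite normr0 ler01.
have [M TM] := bop_bound T; exists `|M| => _ [y y1 <-].
apply: le_trans (TM y) _; apply: (@le_trans _ _ (`|M| * Re `|y|)).
  by apply: ler_wpM2r; [exact: Re_norm_ge0|exact: ler_norm].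
by rewrite -[leRHS]mulr1; apply: ler_wpM2l.
Qed.

Lemma opnorm_le y : Re `|T y| <= opnorm T * Re `|y|.
Proof.
have [->|y0] := eqVneq y 0; first by rewrite linear0 !normr0 mulr0.
have n0 : 0 < Re `|y| by rewrite -ltcR -normcE normr_gt0.
rewrite -ler_pdivrMr //.
have E (V : normedModType R[i]) (v : V) :
    Re `|(Re `|y|)^-1%:C *: v| = Re `|v| / Re `|y|.
  have i0 : 0 <= (Re `|y|)^-1%:C :> R[i] by rewrite lecR invr_ge0 ltW.
  by rewrite normrZ (ger0_norm i0) [X in _ * X]normcE -rmorphM mulrC.
rewrite -E -linearZ; apply: (ub_le_sup opnorm_has_sup.2).
by exists ((Re `|y|)^-1%:C *: y) => //=; rewrite E divff ?gt_eqF.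
Qed.

End OperatorNorm.

(* Sequences indexed by the positive integers are represented as functions
   on nat: the value at k : nat is the term of index k + 1. *)
Section Frames.
Context {R : realType} (Y : hilbertType R).

Definition frame_sum (eta : nat -> Y) (y : Y) : \bar R :=
  (\sum_(0 <= k <oo) (Re `|dotp y (eta k)| ^+ 2)%:E)%E.

Definition bessel_seq (eta : nat -> Y) : Prop :=
  exists2 alpha : R, 0 < alpha &
    forall y, (frame_sum eta y <= (alpha * Re `|y| ^+ 2)%:E)%E.

Definition frame (eta : nat -> Y) : Prop :=
  exists alpha beta : R, [/\ 0 < alpha, 0 < beta &
    forall y, ((beta * Re `|y| ^+ 2)%:E <= frame_sum eta y)%E /\
              (frame_sum eta y <= (alpha * Re `|y| ^+ 2)%:E)%E].

Definition is_synthesis (eta : nat -> Y) (Xi : 'L(ell2 R, Y)) : Prop :=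
  forall w : ell2 R, series (fun k => w k *: eta k) @ \oo --> Xi w.

(* In R[i] the relation 0 <= z means that z is real and nonnegative. *)
Definition op_le (S T : 'L(Y, Y)) : Prop :=
  forall y, 0 <= dotp ((T - S) y) y.

End Frames.

Notation "S '*o' T" := (bop_comp S T) (at level 40, left associativity).

Definition power_stable (R : realType) (X : normedModType R[i]) (gamma : R)
    (F : 'L(X, X)) : Prop :=
  exists2 M : R, 1 <= M & forall k, opnorm (bop_pow F k) <= M * gamma ^+ k.

Section Informativity.
Context {R : realType} (X U : hilbertType R).

Definition Sigma_is (x1 x0 : nat -> X) (u0 : nat -> U) :
    set ('L(X, X) * 'L(U, X)) :=
  [set AB : 'L(X, X) * 'L(U, X) | forall k, x1 k = AB.1 (x0 k) + AB.2 (u0 k)].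

Definition Sigma_stab (K : 'L(X, U)) (M gamma : R) :
    set ('L(X, X) * 'L(U, X)) :=
  [set AB : 'L(X, X) * 'L(U, X) | forall k, opnorm (bop_pow (AB.1 + AB.2 *o K) k) <= M * gamma ^+ k].

Definition stabilizing_gain (gamma : R) (x1 x0 : nat -> X) (u0 : nat -> U)
    (K : 'L(X, U)) : Prop :=
  exists2 M : R, 1 <= M & Sigma_is x1 x0 u0 `<=` Sigma_stab K M gamma.

Definition informative (gamma : R) (x1 x0 : nat -> X) (u0 : nat -> U) : Prop :=
  exists K : 'L(X, U), stabilizing_gain gamma x1 x0 u0 K.

End Informativity.

(* Main.v *)
(* Put P = Xi0^* Xi0 + Ups0^* Ups0 and L = Xi0 + K^* Ups0, so that the operator
   inequality says |L w| <= c |P w|.  Riesz representation on the closure of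
   the range of P then factors <L w, x> = <P w, S x> with S bounded.  Hence the
   defects d = x - Xi0 S x and e = K x - Ups0 S x satisfy
   <Xi0 w, d> + <Ups0 w, e> = 0 for all w.  Adding multiples of rank-one
   operators built from d and e to (As, Bs) stays consistent with the data,
   which forces <x, d> + <K x, e> = 0, so d = e = 0: S is a right inverse of Xi0
   with Ups0 S = K and Xi1 S = As + Bs K.
   Conversely, a right inverse S gives the gain K = Ups0 S, for which
   A + B K = Xi1 S for every compatible (A, B), and L = S^* P. *)
From HB Require Import structures.
Require Import Defs.
From mathcomp Require Import all_boot all_order all_algebra.
From mathcomp Require Import all_classical all_reals all_analysis.
From mathcomp Require Import complex ring lra.
Import Order.TTheory GRing.Theory Num.Theory.
Import numFieldNormedType.Exports.
Import Defs.
Local Open Scope classical_set_scope.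
Local Open Scope ring_scope.
Local Open Scope complex_scope.
Local Notation Re := complex.Re.

(** * Norm estimates, continuity of bounded operators, rank-one operators *)

Section Hilbert.
Set Implicit Arguments.
Unset Strict Implicit.
Context {R : realType}.
Local Notation C := R[i].

Lemma Re_norm_gt0 (V : normedModType C) (v : V) : v != 0 -> 0 < Re `|v|.
Proof. by move=> v0; rewrite -ltcR -normcE normr_gt0. Qed.

Lemma Re_normV_D (V : normedModType C) (u v : V) :
  Re `|u + v| <= Re `|u| + Re `|v|.
Proof. by rewrite -lecR rmorphD /= -!normcE ler_normD. Qed.

Lemma Re_normZ (V : normedModType C) (a : C) (v : V) :
  Re `|a *: v| = Re `|a| * Re `|v|.
Proof. by apply: complexI; rewrite rmorphM /= -!normcE normrZ. Qed.

(** Along the line the norm is at least [|t| |v| - |p|], which is unbounded unless [v = 0]. This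
    turns a bound uniform over a family of perturbed systems into the vanishing of the
    perturbation. *)
Lemma bounded_line_eq0 (V : normedModType C) (p v : V) (b : R) :
  (forall t : C, Re `|p + t *: v| <= b) -> v = 0.
Proof.
move=> h; apply/eqP/contraT => v0; have n0 := Re_norm_gt0 v0.
(* This makes [|t v| = b + |p| + 1], while the triangle inequality caps [|t v|] at [b + |p|]. *)
pose t := (b + Re `|p| + 1) / Re `|v|.
have b0 : 0 <= b by apply: le_trans (h 0); exact: Re_norm_ge0.
have t0 : 0 <= t%:C :> C.
  by rewrite lecR divr_ge0 ?(ltW n0) // !addr_ge0 ?Re_norm_ge0.
have := Re_normV_D (p + t%:C *: v) (- p); rewrite addrAC subrr add0r normrN.
rewrite Re_normZ (ger0_norm t0) /= /t divfK ?gt_eqF //.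
by have := h t%:C; rewrite /t; lra.
Qed.

Lemma bop_bound_gt0 (Y Z : normedModType C) (T : 'L(Y, Z)) :
  exists2 M : R, 0 < M & forall y, Re `|T y| <= M * Re `|y|.
Proof.
have [M TM] := bop_bound T; exists (`|M| + 1) => [|y].
  by rewrite ltr_wpDl.
apply: le_trans (TM y) _; apply: ler_wpM2r; first exact: Re_norm_ge0.
by rewrite (le_trans (ler_norm M)) // lerDl.
Qed.

Lemma bop_cvg (Y Z : normedModType C) (T : 'L(Y, Z)) (u : nat -> Y) (l : Y) :
  u @ \oo --> l -> T (u n) @[n --> \oo] --> T l.
Proof.
have [M M0 TM] := bop_bound_gt0 T.
move=> /cvgrPdist_lt ul; apply/cvgrPdist_lt => e e0.
have er : e = (Re e)%:C by rewrite RRe_real // gtr0_real.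
have re0 : 0 < Re e by rewrite er ltcR in e0.
have e0' : 0 < (Re e / M)%:C by rewrite ltcR divr_gt0.
apply: filterS (ul _ e0') => n; rewrite -linearB er normcE ltcR => h.
rewrite normcE ltcR; apply: le_lt_trans (TM _) _.
by rewrite mulrC -ltr_pdivlMr.
Qed.

Section Dot.
Variable H : hilbertType R.
Implicit Types u v : H.

Lemma Re_dotp_norm u : Re (dotp u u) = Re `|u| ^+ 2.
Proof. by rewrite dotp_norm normcE -rmorphXn. Qed.

Lemma Re_dotp_le u v : Re `|dotp u v| <= Re `|u| * Re `|v|.
Proof. by rewrite -!hnormE; exact: cauchy_schwarz. Qed.

Lemma Re_sqnormD u v :
  Re `|u + v| ^+ 2 = Re `|u| ^+ 2 + Re `|v| ^+ 2 + 2 * Re (dotp u v).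
Proof. by rewrite -!hnormE dnormrD2. Qed.

End Dot.

Lemma adjointEr (Y Z : hilbertType R) (T : 'L(Y, Z)) z y :
  dotp (adjoint T z) y = dotp z (T y).
Proof. by rewrite dot_conj -adjointE -dot_conj. Qed.

Lemma rank_one_subproof (Y Z : hilbertType R) (d : Y) (z : Z) :
  (fun y => dotp y d *: z) \in @bounded_operator R Y Z.
Proof.
apply/asboolP; split=> [a x y|]; first by rewrite linearPl /= scalerDl scalerA.
exists (Re `|d| * Re `|z|) => y; rewrite Re_normZ mulrAC.
by apply: ler_wpM2r; [exact: Re_norm_ge0|rewrite mulrC; exact: Re_dotp_le].
Qed.

Definition rank_one (Y Z : hilbertType R) (d : Y) (z : Z) : 'L(Y, Z) :=
  Bop (rank_one_subproof d z).

End Hilbert.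

(** * Riesz representation on the closure of the range of a linear map *)

Section RieszRange.
Set Implicit Arguments.
Unset Strict Implicit.
Context {R : realType} (Y : lmodType R[i]) (H : hilbertType R).
Local Notation C := R[i].
Variable P : {linear Y -> H}.

(* [s] is the limit of [P w] along a minimizing sequence of
   |P w|^2 - 2 Re (f w). *)
Lemma riesz_range (f : {linear Y -> C^o}) (M : R) :
  (forall w, Re `|f w| <= M * Re `|P w|) ->
  exists2 s, forall w, f w = dotp (P w) s &
    forall e : R, 0 < e -> exists w, Re `|s - P w| < e.
Proof.
move=> fM.
pose q w := Re `|P w| ^+ 2 - 2 * Re (f w).
have qlb w : - M ^+ 2 <= q w.
  have h : Re (f w) <= M * Re `|P w|.
    by apply: le_trans (ler_norm _) _; apply: le_trans (Re_le _) _.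
  by rewrite /q; have := sqr_ge0 (Re `|P w| - M); nra.
pose m := inf (range q).
have qinf : has_inf (range q).
  by split; [exists (q 0), 0|exists (- M ^+ 2) => _ [x _ <-]].
have mq w : m <= q w by apply: ge_inf; [exact: qinf.2|exists w].
have qline w h (t : R) : q (w + t%:C *: h) =
    q w + t ^+ 2 * Re `|P h| ^+ 2 + 2 * t * (Re (dotp (P h) (P w)) - Re (f h)).
  have EP : P (w + t%:C *: h) = t%:C *: P h + P w by rewrite addrC linearP.
  have Ef : f (w + t%:C *: h) = t%:C * f h + f w by rewrite addrC linearP.
  rewrite /q EP Ef Re_sqnormD Re_normZ linearZl_LR /=.
  rewrite ReD !ReM /= !mul0r !subr0 exprMn.
  have -> : Re `|t%:C : C| ^+ 2 = t ^+ 2 by rewrite Re_norm2 /= expr0n addr0.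
  ring.
(* Parallelogram law at the midpoint of [x] and [y]: near-minimizers of [q] have close images under
   [P], although they need not be close themselves. *)
have qpar x y : Re `|P x - P y| ^+ 2 =
    2 * q x + 2 * q y - 4 * q (x + (2^-1)%:C *: (y - x)).
  have nB : Re `|P (y - x)| = Re `|P x - P y| by rewrite linearB hnormB.
  have fB : Re (f (y - x)) = Re (f y) - Re (f x) by rewrite linearB ReB.
  have nD : Re `|P y| ^+ 2 = Re `|P (y - x)| ^+ 2 + Re `|P x| ^+ 2 +
      2 * Re (dotp (P (y - x)) (P x)).
    by rewrite -Re_sqnormD -linearD subrK.
  by rewrite qline /q fB nD nB; field.
have exw n : exists w, q w < m + n.+1%:R^-1.
  have n0 : 0 < n.+1%:R^-1 :> R by rewrite invr_gt0.
  by have [_ [x _ <-] xm] := inf_adherent n0 qinf; exists x.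
have [w wm] := choice exw.
have inv_small (e : R) : 0 < e -> exists n, n.+1%:R^-1 < e.
  move=> e0; exists (Num.truncn e^-1).
  by rewrite invf_plt ?posrE // truncnS_gt.
have le_inv n k : (n <= k)%N -> k.+1%:R^-1 <= n.+1%:R^-1 :> R.
  by move=> nk; rewrite lef_pV2 ?posrE // ler_nat.
have cw : cvgn (fun n => P (w n)).
  apply: cauchy_cvg; apply: cauchy_exP => e e0.
  have er : e = (Re e)%:C by rewrite RRe_real // gtr0_real.
  have re0 : 0 < Re e by rewrite er ltcR in e0.
  (* If both values of [q] are below [m + e^2/4], then [qpar] gives a squared distance below
     [e^2]. *)
  have [N Ne] := inv_small (Re e ^+ 2 / 4) ltac:(by rewrite divr_gt0 ?exprn_gt0).
  exists (P (w N)); exists N => // n /= Nn.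
  rewrite -ball_normE /ball_ /= er normcE ltcR -(@ltr_pXn2r _ 2) ?nnegrE //; last 2 first.
  - exact: Re_norm_ge0.
  - exact: ltW.
  rewrite qpar.
  move: (mq (w N + (2^-1)%:C *: (w n - w N))) (wm N) (wm n) (le_inv _ _ Nn) Ne.
  clearbody q; move: n.+1%:R^-1 N.+1%:R^-1 => a b *; lra.
pose s := limn (fun n => P (w n)).
have near_s (e : R) : 0 < e ->
    exists n, Re `|s - P (w n)| < e /\ n.+1%:R^-1 < e.
  move=> e0; have [N Ne] := inv_small e e0.
  have e0' : 0 < e%:C :> C by rewrite ltcR.
  have /cvgrPdist_lt/(_ _ e0')[N' _ h] : (fun n => P (w n)) @ \oo --> s by [].
  exists (maxn N N'); split; first by rewrite -ltcR -normcE; apply: h => /=; exact: leq_maxr.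
  by apply: le_lt_trans Ne; apply: le_inv; exact: leq_maxl.
have key h : Re (f h) = Re (dotp (P h) s).
  apply/esym/eqP; rewrite -subr_eq0; apply/eqP; set b := (X in X = 0).
  (* First-order optimality at [s]. Since [s] is only a limit of values of [P], minimality is used
     at [w n] and the error is sent to 0. *)
  have ht (t : R) : 0 <= t ^+ 2 * Re `|P h| ^+ 2 + 2 * t * b.
    apply/ler_addgt0Pr => e e0.
    (* [A] collects both errors: [q (w n) - m] costs [e / A], and replacing [P (w n)] by [s] costs
       [2 |t| |P h| e / A]; together they make [e]. *)
    pose A := 1 + 2 * `|t| * Re `|P h|.
    have th0 : 0 <= `|t| * Re `|P h| by rewrite mulr_ge0 // Re_norm_ge0.
    have A0 : 0 < A by rewrite /A; lra.
    have [n [sn ne]] := near_s (e / A) ltac:(by rewrite divr_gt0).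
    have := mq (w n + t%:C *: h); rewrite qline.
    set D := Re (dotp (P h) (P (w n))).
    have bD : `|D - Re (dotp (P h) s)| <= Re `|P h| * (e / A).
      rewrite -ReB -linearBr; apply: le_trans (Re_le _) _.
      apply: le_trans (Re_dotp_le _ _) _; rewrite hnormB.
      by apply: ler_wpM2l; [exact: Re_norm_ge0|exact: ltW].
    have bt : t * (D - Re (dotp (P h) s)) <= `|t| * Re `|P h| * (e / A).
      apply: le_trans (ler_norm _) _; rewrite normrM -mulrA.
      exact: ler_wpM2l.
    have eA : e / A + 2 * (`|t| * Re `|P h| * (e / A)) = e.
      by rewrite /A; field; rewrite gt_eqF.
    move: (wm n) ne bt eA; rewrite /b.
    clearbody q; clear; move: n.+1%:R^-1 (e / A) => d d' *; lra.
  have [->//|b0] := eqVneq b 0.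
  pose N := Re `|P h| ^+ 2 + 1.
  have N0 : 0 < N by rewrite ltr_pwDr // sqr_ge0.
  (* With this [t] the quadratic is [b^2 / N^2] times [|P h|^2 - 2 N = - |P h|^2 - 2 < 0], which
     contradicts [ht]. *)
  have := ht (- b / N).
  rewrite (_ : _ + _ = b ^+ 2 / N ^+ 2 * (Re `|P h| ^+ 2 - 2 * N)); last first.
    by field; rewrite gt_eqF.
  rewrite pmulr_rge0; last first.
    by apply: divr_gt0; [rewrite exprn_even_gt0|rewrite exprn_gt0].
  by rewrite /N; have := sqr_ge0 (Re `|P h|); lra.
exists s => [x|e e0]; last by have [n [? _]] := near_s e e0; exists (w n).
apply/eqP; rewrite eq_complex key eqxx /=.
(* The real part at [i x] is minus the imaginary part at [x]. *)
have := key ('i%C *: x); rewrite !linearZ linearZl_LR /= !ReM /=.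
by rewrite !mul0r !sub0r !mul1r => /oppr_inj ->.
Qed.

End RieszRange.

(** * Douglas-type factorization *)

Section Douglas.
Set Implicit Arguments.
Unset Strict Implicit.
Context {R : realType}.
Local Notation C := R[i].

(** For fixed [x], the functional [w |-> <L w, x>] is bounded by [c |x| |P w|], so Riesz on the
    closure of the range of [P] supplies [S x]. The conclusion amounts to [L = S^* P]. *)
Lemma dotp_factor (W X H : hilbertType R) (P : 'L(W, H)) (L : 'L(W, X)) (c : R) :
  (forall w, Re `|L w| <= c * Re `|P w|) ->
  exists S : 'L(X, H), forall w x, dotp (L w) x = dotp (P w) (S x).
Proof.
move=> LP.
have ex x : exists s : H,
    (forall w, dotp (L w) x = dotp (P w) s) /\
    forall e : R, 0 < e -> exists w, Re `|s - P w| < e.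
  have flin : linear (fun w => dotp (L w) x : C^o).
    by move=> a u v; rewrite linearP linearPl.
  pose f : {linear W -> C^o} :=
    HB.pack (fun w => dotp (L w) x : C^o) (GRing.isLinear.Build _ _ _ _ _ flin).
  have fb w : Re `|f w| <= c * Re `|x| * Re `|P w|.
    apply: le_trans (Re_dotp_le _ _) _; rewrite mulrAC.
    by apply: ler_wpM2r; [exact: Re_norm_ge0|exact: LP].
  by have [s sE sP] := riesz_range fb; exists s.
have [S SE] := choice ex.
(* Each [S x] is a limit of values of [P], which makes it unique and [S] linear. *)
have orth v : (forall w, dotp (P w) v = 0) -> forall x, dotp (S x) v = 0.
  move=> Pv x; apply/eqP; rewrite -normr_eq0 normcE; apply/eqP; congr (_%:C).
  apply/le_anti; rewrite Re_norm_ge0 andbT; apply/ler_addgt0Pr => e e0; rewrite add0r.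
  have n0 : 0 < Re `|v| + 1 by rewrite ltr_wpDl // Re_norm_ge0.
  have [w sw] := (SE x).2 (e / (Re `|v| + 1)) ltac:(by rewrite divr_gt0).
  have -> : dotp (S x) v = dotp (S x - P w) v by rewrite linearBl /= Pv subr0.
  apply: le_trans (Re_dotp_le _ _) _.
  apply: (@le_trans _ _ (e / (Re `|v| + 1) * (Re `|v| + 1))); last by rewrite divfK ?gt_eqF.
  by apply: ler_pM => //; [exact: Re_norm_ge0..|exact: ltW|rewrite lerDl].
have Slin : linear S.
  move=> a x y; apply/eqP; rewrite -subr_eq0 -(dnorm_eq0 dotp).
  set d := _ - _.
  have Pd w : dotp (P w) d = 0.
    rewrite /d linearBr linearPr /= -!(SE _).1 linearPr /= subrr //.
  by rewrite {1}/d linearBl linearPl /= !orth // mulr0 addr0 subr0.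
have Sb : S \in @bounded_operator R X H.
  apply/asboolP; split=> //; exists `|c| => x.
  set n := Re `|S x|; set k := `|c| * Re `|x|.
  have n0 : 0 <= n by exact: Re_norm_ge0.
  have k0 : 0 <= k by rewrite mulr_ge0 // Re_norm_ge0.
  (* Split [|S x|^2 = <S x - P w, S x> + <P w, S x>] with [P w] close to [S x]; the last term equals
     [<L w, x>], of size at most [k |P w|]. *)
  have : n ^+ 2 <= k * n.
    apply/ler_addgt0Pr => e e0; pose e' := e / (k + n + 1).
    have kn0 : 0 < k + n + 1 by rewrite ltr_wpDl // addr_ge0.
    have e'0 : 0 < e' by rewrite divr_gt0.
    have [w sw] := (SE x).2 e' e'0.
    have Pw : Re `|P w| <= n + e'.
      rewrite -[P w](subrK (S x)); apply: le_trans (Re_normV_D _ _) _.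
      by rewrite hnormB addrC lerD2l ltW.
    have h1 : Re (dotp (P w) (S x)) <= k * (n + e').
      rewrite -(SE x).1; apply: le_trans (ler_norm _) _.
      apply: le_trans (Re_le _) _; apply: le_trans (Re_dotp_le _ _) _.
      rewrite /k mulrAC; apply: ler_wpM2r; first exact: Re_norm_ge0.
      apply: le_trans (LP w) _; apply: (@le_trans _ _ (`|c| * Re `|P w|)).
        by apply: ler_wpM2r; [exact: Re_norm_ge0|exact: ler_norm].
      exact: ler_wpM2l.
    have h2 : Re (dotp (S x - P w) (S x)) <= e' * n.
      apply: le_trans (ler_norm _) _.
      apply: le_trans (Re_le _) _; apply: le_trans (Re_dotp_le _ _) _.
      by apply: ler_wpM2r => //; exact: ltW.
    have nE : n ^+ 2 = Re (dotp (S x - P w) (S x)) + Re (dotp (P w) (S x)).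
      by rewrite -ReD -linearDl subrK Re_dotp_norm.
    have eE : e' * (k + n + 1) = e by rewrite divfK ?gt_eqF.
    by rewrite nE; move: h1 h2 eE e'0; lra.
  have [->//|nn] := eqVneq n 0.
  by rewrite expr2 ler_pM2r // lt_neqAle eq_sym nn.
by exists (Bop Sb) => w x; exact: (SE x).1.
Qed.

End Douglas.

(** * Synthesis operators and the lower frame bound *)

Section Synthesis.
Set Implicit Arguments.
Unset Strict Implicit.
Context {R : realType}.
Local Notation C := R[i].

Lemma is_synthesis_unique (Y : hilbertType R) (eta : nat -> Y)
    (Xi Xi' : 'L(ell2 R, Y)) w :
  is_synthesis eta Xi -> is_synthesis eta Xi' -> Xi w = Xi' w.
Proof. by move=> h h'; rewrite -(cvg_lim _ (h w)) // (cvg_lim _ (h' w)). Qed.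

Lemma is_synthesis_comp (Y Z : hilbertType R) (T : 'L(Y, Z)) (eta : nat -> Y)
    (Xi : 'L(ell2 R, Y)) :
  is_synthesis eta Xi -> is_synthesis (T \o eta) (T *o Xi).
Proof.
move=> h w; rewrite (_ : series _ = T \o series (fun k => w k *: eta k)).
  exact: bop_cvg (h w).
apply/funext => n; rewrite /series /= raddf_sum; apply: eq_bigr => k _.
apply: esym; exact: linearZ.
Qed.

Lemma is_synthesisD (Y : hilbertType R) (eta eta' : nat -> Y)
    (Xi Xi' : 'L(ell2 R, Y)) :
  is_synthesis eta Xi -> is_synthesis eta' Xi' ->
  is_synthesis (fun k => eta k + eta' k) (Xi + Xi').
Proof.
move=> h h' w; rewrite (_ : series _ =
    series (fun k => w k *: eta k) + series (fun k => w k *: eta' k)).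
  exact: cvgD (h w) (h' w).
apply/funext => n; rewrite /series /= fctE -big_split; apply: eq_bigr => k _.
by rewrite scalerDr.
Qed.

Lemma delta_summable (j : nat) :
  (fun k => (k == j)%:R : C) \in @square_summable R.
Proof.
apply/asboolP; apply: (@cvgP _ _ (1 : R)).
apply: cvg_near_cst; exists j.+1 => // n /= jn.
rewrite [LHS](_ : _ = \sum_(0 <= k < n) Re `|(k == j)%:R : C| ^+ 2) //.
rewrite (bigD1_seq j) ?mem_index_iota ?iota_uniq // eqxx normr1 expr1n.
by rewrite big1 => [|k /negPf ->]; [exact: addr0|rewrite normr0 expr0n].
Qed.

Definition ell2_delta (j : nat) : ell2 R := Ell2 (delta_summable j).

(** Lets identities between operators on [ell2] be read off at the individual data samples. *)
Lemma synthesis_delta (Y : hilbertType R) (eta : nat -> Y) (Xi : 'L(ell2 R, Y)) j :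
  is_synthesis eta Xi -> Xi (ell2_delta j) = eta j.
Proof.
move=> h; rewrite -(cvg_lim _ (h _)) //; apply: cvg_lim => //.
apply: cvg_near_cst; exists j.+1 => // n /= jn.
rewrite /series /= (bigD1_seq j) ?mem_index_iota ?iota_uniq //= eqxx scale1r.
by rewrite big1 => [|k /negPf ->]; [exact: addr0|rewrite scale0r].
Qed.

Lemma frame_sum_ge (Y : hilbertType R) (eta : nat -> Y) y n :
  ((\sum_(0 <= k < n) Re `|dotp y (eta k)| ^+ 2)%:E <= frame_sum eta y)%E.
Proof.
rewrite -sumEFin; apply: nneseries_lim_ge => k _ _.
by rewrite lee_fin sqr_ge0.
Qed.

(** Pairing [Xi (S y) = y] with [y] gives [|y|^2] as the real part of the sum of [s_k <eta_k, y>],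
    where [s = S y] has norm at most [M |y|]. A weighted AM-GM on each term yields the lower frame
    bound [M^-2]. *)
Lemma synthesis_frame (Y : hilbertType R) (eta : nat -> Y)
    (Xi : 'L(ell2 R, Y)) (S : 'L(Y, ell2 R)) :
  bessel_seq eta -> is_synthesis eta Xi -> Xi *o S = bop_id Y -> frame eta.
Proof.
move=> [alpha alpha0 Ha] h XS; have [M M0 SM] := bop_bound_gt0 S.
exists alpha, (M ^+ 2)^-1; split; rewrite ?invr_gt0 ?exprn_gt0 // => y; split=> //.
(* The Bessel bound makes the frame sum finite, so the estimate can run in the reals. *)
have : frame_sum eta y \is a fin_num.
  rewrite ge0_fin_numE; first exact: le_lt_trans (Ha y) (ltry _).
  by apply: le_trans (frame_sum_ge eta y 0); rewrite big_geq.
set F := frame_sum eta y => /fineK FE; rewrite -FE lee_fin.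
have Fn n : \sum_(0 <= k < n) Re `|dotp y (eta k)| ^+ 2 <= fine F.
  by rewrite -lee_fin FE; exact: frame_sum_ge.
have yE : Xi (S y) = y by rewrite -bop_compE XS.
have cy : Re (dotp (series (fun k => S y k *: eta k) n) y) @[n --> \oo] -->
    Re `|y| ^+ 2.
  rewrite -Re_dotp_norm -[X in dotp X y]yE.
  have m0 : 0 < Re `|y| + 1 by rewrite ltr_wpDl // Re_norm_ge0.
  have lip u v : `|Re (dotp u y) - Re (dotp v y)| <= (Re `|y| + 1) * Re `|u - v|.
    rewrite -ReB -linearBl; apply: le_trans (Re_le _) _.
    apply: le_trans (Re_dotp_le _ _) _; rewrite mulrC.
    by apply: ler_wpM2r; [exact: Re_norm_ge0|rewrite lerDl].
  exact: (lipschitz_cvg _ (h (S y)) m0 lip).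
(* AM-GM: |s_k <eta_k, y>| <= |s_k|^2 / (2 M^2) + M^2 |<y, eta_k>|^2 / 2 *)
have up n : Re (dotp (series (fun k => S y k *: eta k) n) y) <=
    Re `|y| ^+ 2 / 2 + M ^+ 2 * fine F / 2.
  apply: (@le_trans _ _ (\sum_(0 <= k < n)
      ((2 * M ^+ 2)^-1 * Re `|S y k| ^+ 2 +
       M ^+ 2 / 2 * Re `|dotp y (eta k)| ^+ 2))).
    have sumE : Re (dotp (series (fun k => S y k *: eta k) n) y) =
        \sum_(0 <= k < n) Re (dotp (S y k *: eta k) y).
      apply: (big_morph (fun v : Y => Re (dotp v y))) => [u v|].
        by rewrite linearDl ReD.
      by rewrite linear0l.
    rewrite sumE; apply: ler_sum => k _.
    have -> : dotp (S y k *: eta k) y = S y k * dotp (eta k) y.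
      by rewrite linearZl_LR.
    apply: le_trans (ler_norm _) _.
    apply: le_trans (Re_le _) _; rewrite Re_normM [dotp (eta k) y]dot_conj Re_norm_conj.
    set a := Re _; set b := Re _.
    rewrite -subr_ge0 (_ : _ - _ = (a / M - M * b) ^+ 2 / 2); last by field; rewrite gt_eqF.
    by rewrite divr_ge0 // sqr_ge0.
  rewrite big_split /= -!mulr_sumr; apply: lerD.
    rewrite ler_pdivrMl ?mulr_gt0 ?exprn_gt0 //.
    apply: le_trans (ell2_partial_sum_norm _ _) _.
    rewrite [leRHS](_ : _ = (M * Re `|y|) ^+ 2); last by field.
    by rewrite ler_sqr ?nnegrE ?mulr_ge0 ?Re_norm_ge0 // ltW.
  by rewrite mulrAC; apply: ler_wpM2r => //; apply: ler_wpM2l (Fn n); exact: sqr_ge0.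
(* The weights of AM-GM leave only half of [|y|^2] on the right, which is absorbed on the left. *)
have : Re `|y| ^+ 2 <= Re `|y| ^+ 2 / 2 + M ^+ 2 * fine F / 2.
  rewrite -[leLHS](cvg_lim _ cy) //; apply: limr_le; first exact: cvgP cy.
  by apply: nearW => n; exact: (up n).
rewrite ler_pdivrMl ?exprn_gt0 //; lra.
Qed.

End Synthesis.

(** * Compatible pairs, stabilizing gains and the operator inequality *)

Section Gains.
Set Implicit Arguments.
Unset Strict Implicit.
Context {R : realType} (X U : hilbertType R).
Local Notation C := R[i].

Lemma Sigma_is_synthesis (x1 x0 : nat -> X) (u0 : nat -> U)
    (Xi1 Xi0 : 'L(ell2 R, X)) (Ups0 : 'L(ell2 R, U)) A B w :
  is_synthesis x1 Xi1 -> is_synthesis x0 Xi0 -> is_synthesis u0 Ups0 ->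
  Sigma_is x1 x0 u0 (A, B) -> Xi1 w = A (Xi0 w) + B (Ups0 w).
Proof.
move=> h1 h0 hu AB.
apply: (@is_synthesis_unique _ _ x1 Xi1 (A *o Xi0 + B *o Ups0)) => //.
have -> : x1 = fun k => (A \o x0) k + (B \o u0) k by apply/funext.
by apply: is_synthesisD; exact: is_synthesis_comp.
Qed.

(* The bound defining [Sigma_stab] is uniform over the whole affine set
   [Sigma_is], so already its case [k = 1] kills every direction of that set. *)
Lemma stabilizing_gain_orth (x1 x0 : nat -> X) (u0 : nat -> U) A B gamma K d e :
  (exists x : X, x != 0) -> Sigma_is x1 x0 u0 (A, B) ->
  stabilizing_gain gamma x1 x0 u0 K ->
  (forall k, dotp (x0 k) d + dotp (u0 k) e = 0) ->
  forall x, dotp x d + dotp (K x) e = 0.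
Proof.
move=> [z z0] AB [M M1 sub] de x.
suff /eqP : (dotp x d + dotp (K x) e) *: z = 0.
  by rewrite scaler_eq0 (negPf z0) orbF => /eqP.
apply: (@bounded_line_eq0 _ _ ((A + B *o K) x) _ (M * gamma ^+ 1 * Re `|x|)) => t.
(* On the sample [(x0 k, u0 k)] the perturbation adds [t (<x0 k, d> + <u0 k, e>) z = 0], so every
   [t] is allowed, while the bound [M gamma |x|] does not depend on [t]. *)
have /sub/(_ 1%N)/= : Sigma_is x1 x0 u0 (A + t *: rank_one d z, B + t *: rank_one e z).
  move=> k; rewrite -[RHS]/((A (x0 k) + t *: (dotp (x0 k) d *: z)) +
    (B (u0 k) + t *: (dotp (u0 k) e *: z))) addrACA -(AB k).
  by rewrite -scalerDr -scalerDl de scale0r scaler0 addr0.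
set F := _ + _ => hF.
have -> : (A + B *o K) x + t *: ((dotp x d + dotp (K x) e) *: z) = bop_pow F 1 x.
  rewrite -[RHS]/((A x + t *: (dotp x d *: z)) +
    (B (K x) + t *: (dotp (K x) e *: z))).
  by rewrite addrACA -scalerDr -scalerDl.
apply: le_trans (opnorm_le _ _) _; apply: ler_wpM2r => //; exact: Re_norm_ge0.
Qed.

(** The quadratic forms are [|L w|^2] and, by symmetry of [P], [c^2 |P w|^2]; as [c >= 0], square
    roots may be taken. *)
Lemma op_le_gram (W Z : hilbertType R) (L : 'L(W, Z)) (P : 'L(W, W)) (c : R) :
  (forall u v, dotp (P u) v = dotp u (P v)) -> 0 <= c ->
  op_le (adjoint L *o L) ((c ^+ 2)%:C *: bop_pow P 2) <->
  forall w, Re `|L w| <= c * Re `|P w|.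
Proof.
move=> Psym c0.
have E w : dotp (((c ^+ 2)%:C *: bop_pow P 2 - adjoint L *o L) w) w =
    (c ^+ 2 * Re `|P w| ^+ 2 - Re `|L w| ^+ 2)%:C.
  rewrite bop_addE bop_oppE bop_scaleE linearBl linearZl_LR /= adjointEr Psym.
  by rewrite !dotp_norm [`|P w|]normcE [`|L w|]normcE -!rmorphXn -rmorphM -rmorphB.
split=> h w.
  rewrite -(@ler_pXn2r _ 2) ?nnegrE ?mulr_ge0 ?Re_norm_ge0 //.
  by have := h w; rewrite E ler0c exprMn subr_ge0.
rewrite E ler0c subr_ge0 -exprMn ler_pXn2r ?nnegrE ?mulr_ge0 ?Re_norm_ge0 //.
Qed.

End Gains.

(** * Equivalence of the gain condition and the right-inverse condition *)

Theorem theorem6p1 (R : realType) (X U : hilbertType R)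
    (X_nontrivial : exists x : X, x != 0) (U_nontrivial : exists u : U, u != 0)
    (As : 'L(X, X)) (Bs : 'L(U, X))
    (x1 x0 : nat -> X) (u0 : nat -> U)
    (x1_bessel : bessel_seq x1) (x0_bessel : bessel_seq x0)
    (u0_bessel : bessel_seq u0)
    (data : forall k, x1 k = As (x0 k) + Bs (u0 k))
    (Xi1 Xi0 : 'L(ell2 R, X)) (Ups0 : 'L(ell2 R, U))
    (Xi1_synthesis : is_synthesis x1 Xi1)
    (Xi0_synthesis : is_synthesis x0 Xi0)
    (Ups0_synthesis : is_synthesis u0 Ups0)
    (gamma : R) (gamma_gt0 : 0 < gamma) (gamma_lt1 : gamma < 1) :
  (informative gamma x1 x0 u0 /\
   exists (c : R) (K : 'L(X, U)),
     [/\ 0 <= c, stabilizing_gain gamma x1 x0 u0 K &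
       op_le (adjoint (Xi0 + adjoint K *o Ups0) *o (Xi0 + adjoint K *o Ups0))
             ((c ^+ 2)%:C *:
                bop_pow (adjoint Xi0 *o Xi0 + adjoint Ups0 *o Ups0) 2)])
  <->
  (frame x0 /\
   exists Xi0d : 'L(X, ell2 R),
     Xi0 *o Xi0d = bop_id X /\ power_stable gamma (Xi1 *o Xi0d)).
Proof.
set P := adjoint Xi0 *o Xi0 + adjoint Ups0 *o Ups0.
have PE u v : dotp (P u) v = dotp (Xi0 u) (Xi0 v) + dotp (Ups0 u) (Ups0 v).
  by rewrite bop_addE linearDl /= !adjointEr.
have Psym u v : dotp (P u) v = dotp u (P v).
  by rewrite [RHS]dot_conj !PE rmorphD; congr (_ + _); exact: dot_conj.
have LE K w x : dotp ((Xi0 + adjoint K *o Ups0) w) x =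
    dotp (Xi0 w) x + dotp (Ups0 w) (K x).
  by rewrite bop_addE linearDl /= adjointEr.
have hAB : Sigma_is x1 x0 u0 (As, Bs) by [].
split=> [[_ [c [K [c0 Kgain /(op_le_gram _ Psym c0) LP]]]]|[_ [S [XS stabS]]]].
  have [S SE] := dotp_factor LP.
  have VS x : Xi0 (S x) = x /\ Ups0 (S x) = K x.
    pose d := x - Xi0 (S x); pose e := K x - Ups0 (S x).
    have de w : dotp (Xi0 w) d + dotp (Ups0 w) e = 0.
      have := SE w x; rewrite LE PE => h.
      by rewrite /d /e !linearBr /= addrACA h -opprD subrr.
    have de0 k : dotp (x0 k) d + dotp (u0 k) e = 0.
      by have := de (ell2_delta k); rewrite !(synthesis_delta (eta := x0), synthesis_delta (eta := u0)).
    have := stabilizing_gain_orth X_nontrivial hAB Kgain de0 x.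
    have := de (S x) => h1 h2.
    (* This sum is [<x, d> + <K x, e>] minus [<Xi0 (S x), d> + <Ups0 (S x), e>]: the first vanishes
       by the gain property, the second by [de] at [S x]. *)
    have : dotp d d + dotp e e = 0.
      by rewrite {1}/d {2}/e !linearBl /= addrACA h2 -opprD h1 oppr0 addr0.
    move=> /(congr1 (@complex.Re R)); rewrite ReD !Re_dotp_norm => /eqP.
    rewrite paddr_eq0 ?sqr_ge0 // !sqrf_eq0 => /andP[/eqP d0 /eqP e0].
    by split; apply/esym/eqP; rewrite -subr_eq0 -normr_eq0 normcE ?d0 ?e0.
  have XS : Xi0 *o S = bop_id X by apply: bop_eqP => x; exact: (VS x).1.
  split; first exact: synthesis_frame Xi0_synthesis XS.
  exists S; split=> //; have [M M1 sub] := Kgain; exists M => // k.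
  suff -> : Xi1 *o S = As + Bs *o K by exact: (sub _ hAB).
  apply: bop_eqP => x; rewrite bop_compE.
  rewrite (Sigma_is_synthesis _ Xi1_synthesis Xi0_synthesis Ups0_synthesis hAB).
  by rewrite (VS x).1 (VS x).2.
pose K := Ups0 *o S.
have Kgain : stabilizing_gain gamma x1 x0 u0 K.
  have [M M1 hM] := stabS; exists M => // -[A B] AB k /=.
  (* Since [Xi0 S] is the identity, [A + B K = (A Xi0 + B Ups0) S], and compatibility turns the
     bracket into [Xi1]. So one [M] serves all pairs. *)
  suff -> : A + B *o K = Xi1 *o S by [].
  apply: bop_eqP => x; rewrite [RHS]bop_compE.
  rewrite (Sigma_is_synthesis _ Xi1_synthesis Xi0_synthesis Ups0_synthesis AB).
  by rewrite -[Xi0 (S x)]bop_compE XS.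
(* As [L = S^* P], any norm bound of [S^*] serves as the constant [c]. *)
have [c c0 Sc] := bop_bound_gt0 (adjoint S).
split; first by exists K.
exists c, K; split=> //; first exact: ltW.
apply/(op_le_gram _ Psym (ltW c0)) => w.
suff -> : (Xi0 + adjoint K *o Ups0) w = adjoint S (P w) by exact: Sc.
(* Against any [x], [<L w, x> = <Xi0 w, Xi0 S x> + <Ups0 w, Ups0 S x> = <P w, S x>]; here [x] is the
   difference of the two sides itself. *)
apply/eqP; rewrite -subr_eq0 -(dnorm_eq0 dotp) linearBl /= LE adjointEr PE.
by rewrite -[Xi0 (S _)]bop_compE XS subrr.
Qed.
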